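(* Consider the fully discrete scheme: given $f_h\in S_h$ and $u_h^0=0$, find $u_h^m=u_h^m(f_h)\in V_h$ ($m=1,\ldots,M$) such that $$\left(\bar\partial_\tau^\alpha u_h^m,\chi_h\right)+(\nabla u_h^m,\nabla\chi_h)+(u_h^m,\chi_h)=\mu(t_m)\,(f_h,\chi_h),\qquad\forall\,\chi_h\in V_h.$$ This scheme is unconditionally stable. Moreover, there exist constants $C_0,C_1>0$ independent of $h$ and $\tau$ such that for all $f_h\in S_h$ and $m=1,\ldots,M$, $$\text{(i)}\ \ \|u_h^m(f_h)\|_{L^2(\Omega)}\le C_0\|f_h\|_{L^2(\Omega)},\qquad \text{(ii)}\ \ \|\nabla u_h^m(f_h)\|_{L^2(\Omega)}^2\le C_1\|f_h\|_{L^2(\Omega)}^2.$$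
   Context: Setting: $T>0$, $d\in\{1,2,3\}$, $\Omega\subset\mathbb R^d$ is a bounded convex polygonal domain (polyhedral if $d=3$, an interval if $d=1$), $0<\alpha<1$, and $\mu:[0,T]\to\mathbb R$ is a given bounded measurable function. $(\cdot,\cdot)$ is the $L^2(\Omega)$ inner product. Discretization: $\mathcal T_h$ is a shape regular triangulation of $\Omega$ of mesh size $h$; $V_h=\{v_h\in H^1(\Omega):v_h|_A\in P_1(A)\ \forall A\in\mathcal T_h\}$ and $S_h=\{f_h\in L^2(\Omega):f_h|_A\in P_1(A)\ \forall A\in\mathcal T_h\}$, with $P_1(A)$ the linear polynomials (degree at most one) on $A$. For $M\in\mathbb N$, $\tau=T/M$ and $t_m=m\tau$, $m=0,\ldots,M$. L1 approximation of the Caputo derivative: with $d_j=(j+1)^{1-\alpha}-j^{1-\alpha}$, for $m\ge0$, $$\bar\partial_\tau^\alpha u_h^{m+1}:=\frac1{\Gamma(2-\alpha)\,\tau^\alpha}\sum_{j=0}^m d_j\,(u_h^{m+1-j}-u_h^{m-j}).$$ With $b_0=\Gamma(2-\alpha)\tau^\alpha$ and $u_h^0=0$, the scheme is equivalent to: for $m=0,\ldots,M-1$ and all $\chi_h\in V_h$, $(1+b_0)(u_h^{m+1},\chi_h)+b_0(\nabla u_h^{m+1},\nabla\chi_h)=\sum_{j=0}^{m-1}(d_j-d_{j+1})(u_h^{m-j},\chi_h)+b_0\,\mu(t_{m+1})(f_h,\chi_h)$. ''Unconditionally stable'' means that the solution is bounded in terms of $\|f_h\|_{L^2(\Omega)}$,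 uniformly in $h$ and $\tau$, with no restriction relating $\tau$ and $h$. The constants $C_0,C_1$ may depend on $\Omega,T,\alpha,\mu$, but not on $h,\tau,m,f_h$. *)

(* Defs.v *)
From HB Require Import structures.
From mathcomp Require Import all_boot all_order all_algebra.
From mathcomp Require Import all_classical all_reals all_analysis.
From mathcomp Require Import measurable_realfun.

Set Implicit Arguments.
Unset Strict Implicit.
Unset Printing Implicit Defensive.
Import Order.TTheory GRing.Theory Num.Theory.
Import numFieldNormedType.Exports.
Local Open Scope classical_set_scope.
Local Open Scope ring_scope.

(* R^n, as row vectors, carries its Borel sigma-algebra. *)
HB.instance Definition _ (R : realType) (n : nat) :=
  @isMeasurable.Build (sigma_display (@open 'rV[R]_n)) 'rV[R]_n
    <<s @open 'rV[R]_n >> (@sigma_algebra0 _ setT (@open 'rV[R]_n))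
    (@sigma_algebraC _ (@open 'rV[R]_n))
    (@sigma_algebra_bigcup _ setT (@open 'rV[R]_n)).

Section LebesgueMeasure.
Variable R : realType.

Lemma open_measurable_rV n (U : set 'rV[R]_n) : open U -> measurable U.
Proof. exact: sub_sigma_algebra. Qed.

Lemma measurable_coord n (i : 'I_n) :
  measurable_fun [set: 'rV[R]_n] (fun x : 'rV[R]_n => x ord0 i).
Proof.
apply: (measurability _ (RGenOpens.measurableE R)).
move=> _ [_ [a [b ->] <-]]; rewrite setTI; apply: open_measurable_rV.
apply: open_comp; last exact: interval_open.
by move=> x _; exact: coord_continuous.
Qed.

Lemma open_bigcup_ball_rat n (U : set 'rV[R]_n) : open U ->
  U = \bigcup_(q : 'rV[rat]_n * nat)
        (if `[< ball (map_mx ratr q.1 : 'rV[R]_n) q.2.+1%:R^-1 `<=` U >]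
         then [set x : 'rV[R]_n | forall i,
                 ball (ratr (q.1 ord0 i) : R) q.2.+1%:R^-1 (x ord0 i)]
         else set0).
Proof.
move=> oU; apply/seteqP; split => [x Ux|x [[q k] _] /=]; last first.
  case: asboolP => // sU qx; apply: sU; split=> [|i j]; first by rewrite invr_gt0.
  by rewrite ord1 mxE; exact: qx.
have /nbhs_ballP[e /= e0 xeU] : nbhs x U by exact: open_nbhs_nbhs.
have [k] := ltr_add_invr (y := 0) (x := e / 2) (divr_gt0 e0 (ltr0n _ 2)).
rewrite add0r => ke.
pose r : R := k.+1%:R^-1.
have r0 : 0 < r by rewrite invr_gt0.
have /choice[q qP] : forall i : 'I_n, exists p : rat,
    (ratr p : R) \in `](x ord0 i - r), (x ord0 i + r)[.
  move=> i; have /rat_in_itvoo[p pP] : x ord0 i - r < x ord0 i + r.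
    by rewrite ltrBlDr -addrA ltrDl addr_gt0.
  by exists p.
have qx i : ball (ratr (q i) : R) r (x ord0 i).
  by rewrite /ball /= ltr_distl; have := qP i; rewrite in_itv.
exists (\row_i q i, k) => //=; case: asboolP => [_ i|]; first by rewrite mxE.
case=> y [_ yq]; apply: xeU; split => // i j; rewrite ord1.
have := yq ord0 j; rewrite !mxE => /= qy.
apply: (@le_ball _ _ _ (r + r)).
  by rewrite (splitr e) lerD// ltW.
by apply: ball_triangle qy; apply: ball_sym; exact: qx.
Qed.

Lemma measurable_fun_rV d (X : measurableType d) n (f : X -> 'rV[R]_n) :
  (forall i, measurable_fun [set: X] (fun x => f x ord0 i)) ->
  measurable_fun [set: X] f.
Proof.
move=> mf; apply: (@measurability _ _ _ _ _ _ (@open 'rV[R]_n)) => //.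
move=> _ [U oU <-]; rewrite setTI (open_bigcup_ball_rat oU) preimage_bigcup.
apply: countable_bigcupT_measurable; first exact: countableP.
move=> [q k] /=; case: asboolP => _; last by rewrite preimage_set0.
rewrite (_ : _ @^-1` _ = \bigcap_(i : 'I_n)
    ((fun x => f x ord0 i) @^-1` ball (ratr (q ord0 i) : R) k.+1%:R^-1)).
  apply: fin_bigcap_measurable; first exact: finite_finset.
  move=> i _; rewrite -[X in measurable X]setTI; apply: mf => //.
  by apply: open_measurable; exact: ball_open; rewrite invr_gt0.
by apply/seteqP; split => x /= h i; [move=> _; exact: h|exact: (h i I)].
Qed.


Definition rV_cons n (p : R * 'rV[R]_n) : 'rV[R]_n.+1 :=
  \row_i oapp (fun j => p.2 ord0 j) p.1 (unlift ord0 i).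

Lemma measurable_rV_cons n :
  measurable_fun [set: measurableTypeR R * 'rV[R]_n] (@rV_cons n).
Proof.
apply: measurable_fun_rV => i; rewrite /rV_cons.
case: (unliftP ord0 i) => [j ->|->].
  rewrite (_ : (fun _ => _) = (fun x : 'rV[R]_n => x ord0 j) \o snd).
    by apply: measurableT_comp => //; exact: measurable_coord.
  by apply/funext => p; rewrite mxE liftK.
rewrite (_ : (fun _ => _) = fst) //.
by apply/funext => p; rewrite mxE unlift_none.
Qed.

Section cons_measure.
Variables (n : nat) (m : {sigma_finite_measure set 'rV[R]_n -> \bar R}).

Definition cons_measure : set 'rV[R]_n.+1 -> \bar R :=
  pushforward (@lebesgue_measure R \x m)%E (@rV_cons n).

Let mcons := @measurable_rV_cons n.

Let cons_measure0 : cons_measure set0 = 0%E.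
Proof. by rewrite /cons_measure /pushforward preimage_set0 measure0. Qed.

Let cons_measure_ge0 A : (0 <= cons_measure A)%E.
Proof. by rewrite /cons_measure /pushforward; apply: measure_ge0. Qed.

Let cons_measure_sigma_additive : semi_sigma_additive cons_measure.
Proof.
pose nu := @pushforward _ _ _ _ R (@lebesgue_measure R \x m)%E (@rV_cons n).
exact: (@measure_semi_sigma_additive _ _ _ nu).
Qed.

HB.instance Definition _ := isMeasure.Build _ _ _ cons_measure
  cons_measure0 cons_measure_ge0 cons_measure_sigma_additive.

Let cons_measure_sigma_finite : sigma_finite setT cons_measure.
Proof.
have [F TF mF] : sigma_finite setT (@lebesgue_measure R \x m)%E.
  have /sigma_finiteP[F [TF ndF Foo]] := sigma_finiteT (@lebesgue_measure R).
  have /sigma_finiteP[G [TG ndG Goo]] := sigma_finiteT m.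
  exists (fun k => F k `*` G k).
    rewrite -setXTT TF TG predeqE => -[x y]; split.
      move=> [/= [k _ Fkx] [l _ Gly]]; exists (maxn k l) => //; split.
      - by move: x Fkx; exact/subsetPset/ndF/leq_maxl.
      - by move: y Gly; exact/subsetPset/ndG/leq_maxr.
    by move=> [k _ []/= ? ?]; split; exists k.
  move=> k; have [? ?] := Foo k; have [? ?] := Goo k.
  split; first exact: measurableX.
  by rewrite product_measure1E// lte_mul_pinfty// ge0_fin_numE.
pose g (x : 'rV[R]_n.+1) : measurableTypeR R * 'rV[R]_n :=
  (x ord0 ord0, \row_j x ord0 (lift ord0 j)).
have gK : cancel (@rV_cons n) g.
  move=> [a v]; rewrite /g /rV_cons; congr pair; first by rewrite mxE unlift_none.
  by apply/rowP => j; rewrite !mxE liftK.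
have mg : measurable_fun setT g.
  apply/measurable_fun_pair; first exact: measurable_coord.
  apply: measurable_fun_rV => j /=.
  rewrite (_ : (fun _ => _) = fun x : 'rV[R]_n.+1 => x ord0 (lift ord0 j)).
    exact: measurable_coord.
  by apply/funext => x; rewrite mxE.
exists (fun i => g @^-1` F i); first by rewrite -preimage_bigcup -TF preimage_setT.
move=> i; split; first by rewrite -[X in measurable X]setTI; apply: mg => //; case: (mF i).
rewrite /cons_measure /pushforward -comp_preimage.
rewrite (_ : g \o @rV_cons n = id) ?preimage_id; first by case: (mF i).
by apply/funext => p; exact: gK.
Qed.

HB.instance Definition _ := Measure_isSigmaFinite.Build _ _ _ cons_measure
  cons_measure_sigma_finite.

End cons_measure.

Fixpoint lebesgue_rV n : {sigma_finite_measure set 'rV[R]_n -> \bar R} :=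
  if n is n'.+1 then cons_measure (lebesgue_rV n')
  else \d_(0 : 'rV[R]_0).

Lemma lebesgue_rV_box n (A : 'I_n -> set R) : (forall i, measurable (A i)) ->
  lebesgue_rV n [set x | forall i, A i (x ord0 i)] =
  (\prod_(i < n) lebesgue_measure (A i))%E.
Proof.
elim: n A => [|n IH] A mA /=.
  by rewrite big_ord0 diracE mem_set // => -[].
rewrite big_ord_recl -IH //.
pose B := [set x : 'rV[R]_n | forall i, A (lift ord0 i) (x ord0 i)].
have mB : measurable B.
  rewrite (_ : B = \bigcap_(i : 'I_n)
      ((fun x : 'rV[R]_n => x ord0 i) @^-1` A (lift ord0 i))).
    apply: fin_bigcap_measurable; first exact: finite_finset.
    move=> i _; rewrite -[X in measurable X]setTI; exact: measurable_coord.
  by apply/seteqP; split => x /= h i; [move=> _; exact: h|exact: (h i I)].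
transitivity ((@lebesgue_measure R \x lebesgue_rV n)%E (A ord0 `*` B)); last first.
  by have := product_measure1E (@lebesgue_measure R) (lebesgue_rV n) (mA ord0) mB; move=> ->.
rewrite /cons_measure /pushforward; congr (_ _); apply/seteqP; split => -[a v] /=.
  move=> h; split; first by have := h ord0; rewrite mxE unlift_none.
  by move=> i; have := h (lift ord0 i); rewrite mxE liftK.
by move=> [ha hv] i; rewrite mxE; case: (unliftP ord0 i) => [j ->|->] //=.
Qed.

End LebesgueMeasure.

Section Sobolev.
Variables (R : realType) (d : nat).
Implicit Types (Omega : set 'rV[R]_d) (v g phi : 'rV[R]_d -> R).
Implicit Types G H : 'I_d -> 'rV[R]_d -> R.
Local Notation leb := (lebesgue_rV R d).

Definition L2 Omega v : Prop := v \_ Omega \in Lfun leb 2%:E.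

Definition l2dot Omega v g : R := \int[leb]_(x in Omega) (v x * g x).

Definition l2norm Omega v : R := Num.sqrt (l2dot Omega v v).

Definition l2dot_vec Omega G H : R := \sum_(i < d) l2dot Omega (G i) (H i).

Definition l2norm_vec Omega G : R := Num.sqrt (l2dot_vec Omega G G).

Definition partial (i : 'I_d) phi : 'rV[R]_d -> R :=
  fun x => 'D_(delta_mx ord0 i) phi x.

Fixpoint class_C (k : nat) phi : Prop :=
  continuous phi /\
  if k is k'.+1 then
    forall i : 'I_d, (forall x, derivable phi x (delta_mx ord0 i)) /\
                     class_C k' (partial i phi)
  else True.

Definition test_function Omega phi : Prop :=
  (forall k, class_C k phi) /\
  exists K : set 'rV[R]_d, [/\ compact K, K `<=` Omega &
    forall x, ~ K x -> phi x = 0].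

Definition weak_gradient Omega v G : Prop :=
  forall i : 'I_d, L2 Omega (G i) /\
    forall phi, test_function Omega phi ->
      l2dot Omega v (partial i phi) = - l2dot Omega (G i) phi.

Definition H1 Omega v : Prop :=
  L2 Omega v /\ exists G, weak_gradient Omega v G.

End Sobolev.

Section Mesh.
Variables (R : realType) (d : nat).
Implicit Types (Omega A B F : set 'rV[R]_d) (Th : set (set 'rV[R]_d)).
Implicit Types v f : 'rV[R]_d -> R.

Definition eucl_norm (x : 'rV[R]_d) : R :=
  Num.sqrt (\sum_(i < d) x ord0 i ^+ 2).

Definition conv_hull n (p : 'I_n -> 'rV[R]_d) (I : {pred 'I_n}) :
    set 'rV[R]_d :=
  [set x | exists w : 'I_n -> R,
    [/\ forall i, 0 <= w i, \sum_(i | i \in I) w i = 1 &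
        x = \sum_(i | i \in I) w i *: p i]].

Definition affinely_independent n (p : 'I_n -> 'rV[R]_d) : Prop :=
  forall w : 'I_n -> R,
    \sum_i w i = 0 -> \sum_i w i *: p i = 0 -> forall i, w i = 0.

Definition convex_polytopal_domain Omega : Prop :=
  [/\ open Omega, Omega !=set0, bounded_set Omega,
      convex_set (Omega : set (convex_lmodType 'rV[R]_d)) &
      exists (n : nat) (p : 'I_n -> 'rV[R]_d),
        closure Omega = conv_hull p predT].

Definition simplex_vertices A (p : 'I_d.+1 -> 'rV[R]_d) : Prop :=
  affinely_independent p /\ A = conv_hull p predT.

(* The empty set is the face spanned by no vertex. *)
Definition face A F : Prop :=
  exists (p : 'I_d.+1 -> 'rV[R]_d) (I : {pred 'I_d.+1}),
    simplex_vertices A p /\ F = conv_hull p I.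

(* The simplices are closed, so conformity is the last clause: two of them
   meet along a common (possibly empty) face. *)
Definition triangulation Omega Th : Prop :=
  [/\ finite_set Th,
      forall A, Th A -> exists p, simplex_vertices A p,
      \bigcup_(A in Th) A = closure Omega &
      forall A B, Th A -> Th B -> face A (A `&` B) /\ face B (A `&` B)].

Definition diam A : R :=
  sup [set eucl_norm (x.1 - x.2) | x in A `*` A].

Definition mesh_size Th (h : R) : Prop :=
  (forall A, Th A -> diam A <= h) /\ exists2 A, Th A & diam A = h.

(* Each simplex contains a ball of radius at least its diameter over kappa. *)
Definition shape_regular (kappa : R) Th : Prop :=
  forall A, Th A -> exists (c : 'rV[R]_d) (rho : R),
    [/\ 0 < rho, [set x | eucl_norm (x - c) <= rho] `<=` A &
        diam A <= kappa * rho].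

(* Almost everywhere on A: members of S_h jump across the faces shared by
   neighbouring (closed) simplices. *)
Definition is_P1_on A v : Prop :=
  exists (a : 'I_d -> R) (b : R),
    {ae lebesgue_rV R d,
      forall x, A x -> v x = \sum_(i < d) a i * x ord0 i + b}.

Definition V_space Omega Th v : Prop :=
  H1 Omega v /\ forall A, Th A -> is_P1_on A v.

Definition S_space Omega Th f : Prop :=
  L2 Omega f /\ forall A, Th A -> is_P1_on A f.

End Mesh.

Section Scheme.
Variable R : realType.

Definition Gamma (z : R) : R :=
  \int[lebesgue_measure]_(t in `]0, +oo[) (t `^ (z - 1) * expR (- t)).

Definition L1_weight (alpha : R) (j : nat) : R :=
  j.+1%:R `^ (1 - alpha) - j%:R `^ (1 - alpha).

(* The L1 approximation at level m.+1. *)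
Definition L1_caputo d (alpha tau : R) (u : nat -> 'rV[R]_d -> R) (m : nat) :
    'rV[R]_d -> R :=
  fun x => (Gamma (2 - alpha) * tau `^ alpha)^-1 *
    \sum_(j < m.+1) L1_weight alpha j * (u (m.+1 - j)%N x - u (m - j)%N x).

(* A weak gradient is determined only almost everywhere, so the equation is
   required for every representative Du of the gradient of u m.+1 and every
   representative Dchi of the gradient of chi. *)
Definition scheme_solution d (Omega : set 'rV[R]_d) (T alpha : R)
    (mu : R -> R) (Th : set (set 'rV[R]_d)) (M : nat) (f : 'rV[R]_d -> R)
    (u : nat -> 'rV[R]_d -> R) : Prop :=
  let tau := T / M%:R in
  [/\ forall m, (m <= M)%N -> V_space Omega Th (u m),
      {ae lebesgue_rV R d, forall x, Omega x -> u 0%N x = 0} &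
      forall m, (m < M)%N -> forall chi, V_space Omega Th chi ->
      forall Du Dchi, weak_gradient Omega (u m.+1) Du ->
        weak_gradient Omega chi Dchi ->
        l2dot Omega (L1_caputo alpha tau u m) chi + l2dot_vec Omega Du Dchi
          + l2dot Omega (u m.+1) chi
        = mu (m.+1%:R * tau) * l2dot Omega f chi].

(* The bound is uniform over all meshes and all time steps, with no condition
   relating h to T / M. *)
Definition unconditionally_stable d (Omega : set 'rV[R]_d) (T alpha : R)
    (mu : R -> R) : Prop :=
  exists C : R, forall (Th : set (set 'rV[R]_d)) (kappa h : R) (M : nat)
      (f : 'rV[R]_d -> R) (u : nat -> 'rV[R]_d -> R),
    triangulation Omega Th -> shape_regular kappa Th -> mesh_size Th h ->
    (0 < M)%N -> S_space Omega Th f ->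
    scheme_solution Omega T alpha mu Th M f u ->
    forall m, (m <= M)%N -> l2norm Omega (u m) <= C * l2norm Omega f.

End Scheme.

(* Main.v *)
Require Import Defs.
From mathcomp Require Import all_boot all_order all_algebra.
From mathcomp Require Import all_classical all_reals all_analysis.
From mathcomp Require Import measurable_realfun ring lra.

Set Implicit Arguments.
Unset Strict Implicit.
Unset Printing Implicit Defensive.
Import Order.TTheory GRing.Theory Num.Theory.
Import numFieldNormedType.Exports.
Local Open Scope classical_set_scope.
Local Open Scope ring_scope.

(** Both bounds are energy estimates. Write c = 1 / (Gamma (2 - alpha) tau^alpha)
and let d_j be the L1 weights. Concavity of the power function makes d_j
positive and nonincreasing, with d_0 = 1, so that after a summation by parts
the L1 difference is c (u_{m+1} - sum_j (d_j - d_{j+1}) u_{m-j}): the new value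
minus a combination of the earlier ones, with nonnegative weights of total mass
1 - d_m. Hence, for any positive semidefinite symmetric form e, twice the
pairing of the L1 difference with u_{m+1} dominates the L1 difference of e(u, u)
([L1_diff_coercive]), and a discrete comparison principle
([L1_weight_comparison]) turns the resulting recursive inequalities into
uniform bounds.

For (i), the scheme is tested with u_{m+1} and e is the L2 inner product. The
zeroth order term of the scheme absorbs the source, so the bound is K |f| with
K a bound of |mu|; neither T nor the time step enters.

For (ii), testing with u_{m+1} would leave a factor 1 / tau^alpha. The scheme
is tested with the L1 difference D of u instead, which is again a finite
element function: |D|^2 + e(u_{m+1}, D) = mu (f, D), where now e is the H1
energy, and Young's inequality gives e(u_{m+1}, D) <= K^2 |f|^2 / 4. The
comparison principle then needs c d_m to be bounded below, which holds since
d_m >= (1 - alpha) (m + 1)^(- alpha) >= (1 - alpha) M^(- alpha) while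
c = M^alpha / (Gamma (2 - alpha) T^alpha): the dependence on M cancels.

The gradient of a member of H1 is only a choice of representative, so the
argument runs on pairs of a function and one of its weak gradients
([fe_graph]); these pairs form a vector space on which the energy is an honest
bilinear form. *)

(** * The weights of the L1 scheme *)

Section Weights.
Variable R : realType.
Implicit Types s x y alpha : R.

(** A concave function lies below its tangents. Deriving this from Young's
inequality avoids differentiating at y = 0, where the power is not
differentiable. *)
Lemma powR_tangent_le s x y : 0 < s < 1 -> 0 < x -> 0 <= y ->
  y `^ s <= x `^ s + s * x `^ (s - 1) * (y - x).
Proof.
move=> /andP[s0 s1] x0 y0.
have s1' : 0 < 1 - s by rewrite subr_gt0.
have := @conjugate_powR _ (y `^ s) (x `^ (1 - s)) s^-1 (1 - s)^-1
  (powR_ge0 _ _) (powR_ge0 _ _).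
rewrite !invr_gt0 !invrK -!powRrM !mulfV ?gt_eqF// !powRr1 ?(ltW x0)//.
move=> /(_ s0 s1' (subrKC _ _)) young.
have xs : x `^ (1 - s) * x `^ (s - 1) = 1.
  rewrite -powRD; last by rewrite (gt_eqF x0) implybT.
  by rewrite (_ : 1 - s + (s - 1) = 0) ?powRr0//; ring.
rewrite -(ler_pM2r (powR_gt0 (s - 1) x0)) in young.
have xxs := mulr_powRB1 (ltW x0) s0.
apply: (le_trans _ (le_trans young _)); first by rewrite -mulrA xs mulr1.
by rewrite -xxs; lra.
Qed.

Lemma L1_weight0 alpha : alpha < 1 -> L1_weight alpha 0 = 1.
Proof.
by move=> a1; rewrite /L1_weight powR1 powR0 ?subr0// gt_eqF// subr_gt0.
Qed.

(** The number (1 - alpha) (j + 1)^(- alpha) is the slope at j + 1 of the concave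
function x^(1 - alpha): it lies between the chord slope d_j on its left and
the chord slope d_{j+1} on its right. *)
Lemma L1_weight_ge alpha j : 0 < alpha < 1 ->
  (1 - alpha) * j.+1%:R `^ (- alpha) <= L1_weight alpha j.
Proof.
move=> a01; have s01 : 0 < 1 - alpha < 1 by lra.
have := powR_tangent_le s01 (ltr0Sn R j) (ler0n R j).
rewrite /L1_weight -(natr1 j) (_ : 1 - alpha - 1 = - alpha); last by ring.
by set a := _ `^ _; set b := _ `^ _; set c := _ `^ _; lra.
Qed.

Lemma L1_weightS_le alpha j : 0 < alpha < 1 ->
  L1_weight alpha j.+1 <= (1 - alpha) * j.+1%:R `^ (- alpha).
Proof.
move=> a01; have s01 : 0 < 1 - alpha < 1 by lra.
have := powR_tangent_le s01 (ltr0Sn R j) (ler0n R j.+2).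
rewrite /L1_weight -(natr1 j.+1) (_ : 1 - alpha - 1 = - alpha); last by ring.
by set a := _ `^ _; set b := _ `^ _; set c := _ `^ _; lra.
Qed.

Lemma L1_weight_noninc alpha j : 0 < alpha < 1 ->
  L1_weight alpha j.+1 <= L1_weight alpha j.
Proof. by move=> a; exact: le_trans (L1_weightS_le _ a) (L1_weight_ge _ a). Qed.

Lemma L1_weight_gt0 alpha j : 0 < alpha < 1 -> 0 < L1_weight alpha j.
Proof.
move=> a; apply: lt_le_trans (L1_weight_ge _ a).
by rewrite mulr_gt0 ?powR_gt0//; lra.
Qed.

Lemma L1_weight_sum_by_parts alpha (a : nat -> R) m : alpha < 1 -> a 0%N = 0 ->
  \sum_(j < m.+1) L1_weight alpha j * (a (m.+1 - j)%N - a (m - j)%N) =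
  a m.+1 - \sum_(j < m) (L1_weight alpha j - L1_weight alpha j.+1) * a (m - j)%N.
Proof.
move=> a1 a0.
under eq_bigr do rewrite mulrBr.
rewrite sumrB big_ord_recl L1_weight0// mul1r subn0 -addrA; congr (_ + _).
rewrite [X in _ - X]big_ord_recr/= subnn a0 mulr0 addr0.
under [in RHS]eq_bigr do rewrite mulrBl.
by rewrite sumrB opprB; congr (_ - _); apply: eq_bigr => i _; rewrite lift0 subSS.
Qed.

Lemma L1_weight_telescope alpha m : alpha < 1 ->
  \sum_(j < m) (L1_weight alpha j - L1_weight alpha j.+1) =
  1 - L1_weight alpha m :> R.
Proof.
move=> a1; elim: m => [|m IH]; first by rewrite big_ord0 L1_weight0// subrr.
by rewrite big_ord_recr/= IH; ring.
Qed.

(** Discrete comparison principle. The constant G satisfies the recursion with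
equality, since the weights d_j - d_{j+1} sum to 1 - d_m. The term in k is the
damping by the zeroth order term, and 2 c d_m G is the largest source that
the memory term absorbs without damping. *)
Lemma L1_weight_comparison alpha (c k G : R) (E : nat -> R) M :
  0 < alpha < 1 -> 0 < c -> 0 <= k ->
  (forall m, (m < M)%N ->
    (c * (1 + L1_weight alpha m) + k) * E m.+1 <=
    c * \sum_(j < m) (L1_weight alpha j - L1_weight alpha j.+1) * E (m - j)%N
    + (2 * c * L1_weight alpha m + k) * G) ->
  forall m, (0 < m <= M)%N -> E m <= G.
Proof.
move=> a01 c0 k0 Estep.
elim/ltn_ind => -[//|m] IH /= mM.
have d0 := L1_weight_gt0 m a01.
have past : \sum_(j < m) (L1_weight alpha j - L1_weight alpha j.+1) * E (m - j)%N
    <= (1 - L1_weight alpha m) * G.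
  case/andP: (a01) => _ /L1_weight_telescope <-; rewrite mulr_suml.
  apply: ler_sum => -[j jm] _ /=; apply: ler_wpM2l.
    by rewrite subr_ge0 L1_weight_noninc.
  apply: IH; rewrite ?ltnS ?leq_subr// subn_gt0 jm/=.
  by rewrite (leq_trans (leq_subr _ _))// ltnW.
have q0 : 0 < c * (1 + L1_weight alpha m) + k.
  by rewrite ltr_wpDr// mulr_gt0// ltr_wpDr// ltW.
rewrite -(ler_pM2l q0); apply: le_trans (Estep _ mM) _.
rewrite [leRHS](_ : _ = c * ((1 - L1_weight alpha m) * G)
  + (2 * c * L1_weight alpha m + k) * G); last by ring.
by rewrite lerD2r ler_pM2l.
Qed.

End Weights.

(** * L1 differences in a semi-inner product space *)

(** Only symmetry and positivity hold on the whole space: an integral of a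
product splits over sums only under integrability, whence the domain P. *)
Record semi_inner_on (R : realType) (V : lmodType R) (P : V -> Prop)
    (e : V -> V -> R) : Prop := SemiInnerOn {
  semi_inner_dom0 : P 0 ;
  semi_inner_domL : forall a x y, P x -> P y -> P (a *: x + y) ;
  semi_innerC : forall x y, e x y = e y x ;
  semi_innerL : forall a x y z, P x -> P y -> P z ->
    e (a *: x + y) z = a * e x z + e y z ;
  semi_inner_ge0 : forall x, 0 <= e x x }.

Definition L1_diff (R : realType) (V : lmodType R) (alpha c : R)
    (z : nat -> V) (m : nat) : V :=
  c *: \sum_(j < m.+1) L1_weight alpha j *: (z (m.+1 - j)%N - z (m - j)%N).

Lemma L1_diff_fst (R : realType) (U V : lmodType R) (alpha c : R)
    (z : nat -> U * V) m :
  (L1_diff alpha c z m).1 = L1_diff alpha c (fst \o z) m.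
Proof. by rewrite /L1_diff/= (big_morph fst (fun _ _ => erefl) erefl). Qed.

Section SemiInner.
Variables (R : realType) (V : lmodType R) (P : V -> Prop) (e : V -> V -> R).
Hypothesis eP : semi_inner_on P e.
Implicit Types (x y : V) (z : nat -> V) (alpha c a : R).

Lemma semi_inner_domB x y : P x -> P y -> P (x - y).
Proof. by move=> Px Py; rewrite addrC -scaleN1r; exact: (semi_inner_domL eP). Qed.

Lemma semi_innerBl x y v : P x -> P y -> P v -> e (x - y) v = e x v - e y v.
Proof.
move=> Px Py Pv; rewrite addrC -scaleN1r (semi_innerL eP)// mulN1r.
by rewrite addrC.
Qed.

Lemma semi_inner_sum n (a : 'I_n -> R) (x : 'I_n -> V) : (forall i, P (x i)) ->
  P (\sum_i a i *: x i) /\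
  forall y, P y -> e (\sum_i a i *: x i) y = \sum_i a i * e (x i) y.
Proof.
elim: n a x => [|n IH] a x Px.
  rewrite big_ord0; split=> [|y Py]; first exact: (semi_inner_dom0 eP).
  have P0 := semi_inner_dom0 eP.
  by rewrite big_ord0 -[X in e X](subrr 0) semi_innerBl// subrr.
have [Ps es] := IH (a \o lift ord0) (x \o lift ord0) (fun=> Px _).
rewrite big_ord_recl; split=> [|y Py]; first exact: (semi_inner_domL eP).
by rewrite (semi_innerL eP)// es// big_ord_recl.
Qed.

(** This is the positivity of e (x - a y) (x - a y). *)
Lemma semi_inner_young a x y : P x -> P y ->
  2 * a * e x y <= e x x + a ^+ 2 * e y y.
Proof.
move=> Px Py; have Pxy : P (- a *: y + x) by exact: (semi_inner_domL eP).
have := semi_inner_ge0 eP (- a *: y + x).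
rewrite (semi_innerL eP)// (semi_innerC eP y) (semi_innerC eP x).
rewrite !(semi_innerL eP)// (semi_innerC eP y x).
set exy := e x y; set exx := e x x; set eyy := e y y; lra.
Qed.

Lemma L1_diff_dom alpha c z m : (forall k, (k <= m.+1)%N -> P (z k)) ->
  P (L1_diff alpha c z m).
Proof.
move=> Pz; have P0 := semi_inner_dom0 eP.
rewrite /L1_diff -[X in P X]addr0; apply: (semi_inner_domL eP) => //.
apply: (semi_inner_sum _ _).1 => i; apply: semi_inner_domB; apply: Pz.
  exact: leq_subr.
by rewrite (leq_trans (leq_subr _ _)).
Qed.

Lemma semi_inner_L1_diff alpha c z m y :
  (forall k, (k <= m.+1)%N -> P (z k)) -> P y ->
  e (L1_diff alpha c z m) y =
  c * \sum_(j < m.+1) L1_weight alpha j *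
    (e (z (m.+1 - j)%N) y - e (z (m - j)%N) y).
Proof.
move=> Pz Py; have P0 := semi_inner_dom0 eP.
have Pz1 (j : 'I_m.+1) : P (z (m.+1 - j)%N) by apply: Pz; exact: leq_subr.
have Pz2 (j : 'I_m.+1) : P (z (m - j)%N).
  by apply: Pz; rewrite (leq_trans (leq_subr _ _)).
have [Ps es] := semi_inner_sum (fun j : 'I_m.+1 => L1_weight alpha j)
  (fun j => semi_inner_domB (Pz1 j) (Pz2 j)).
have e0 : e 0 y = 0 by rewrite -[X in e X](subrr 0) semi_innerBl// subrr.
rewrite /L1_diff -[X in e X]addr0 (semi_innerL eP)// e0 addr0 es//.
by congr (_ * _); apply: eq_bigr => j _; rewrite semi_innerBl.
Qed.

(** After summation by parts, each cross term e (z_{m-j}) (z_{m+1}) is at most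
the half sum of the two squares; the squares at time m + 1 then have total
weight 1 - d_m, which leaves 2 - (1 - d_m) = 1 + d_m in front of
e (z_{m+1}) (z_{m+1}). *)
Lemma L1_diff_coercive alpha c z m : 0 < alpha < 1 -> 0 <= c ->
  (forall k, (k <= m.+1)%N -> P (z k)) -> (forall y, P y -> e (z 0%N) y = 0) ->
  c * ((1 + L1_weight alpha m) * e (z m.+1) (z m.+1) -
    \sum_(j < m) (L1_weight alpha j - L1_weight alpha j.+1) *
      e (z (m - j)%N) (z (m - j)%N))
  <= 2 * e (L1_diff alpha c z m) (z m.+1).
Proof.
move=> a01 c0 Pz z0; case/andP: (a01) => _ a1.
rewrite semi_inner_L1_diff//; last exact: Pz.
rewrite (L1_weight_sum_by_parts (a := fun k => e (z k) (z m.+1)))//; last first.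
  exact/z0/Pz.
rewrite mulrCA; apply: ler_wpM2l => //.
set x := e (z m.+1) (z m.+1).
suff : \sum_(j < m) (L1_weight alpha j - L1_weight alpha j.+1) *
    (2 * e (z (m - j)%N) (z m.+1)) <=
  \sum_(j < m) (L1_weight alpha j - L1_weight alpha j.+1) *
    (e (z (m - j)%N) (z (m - j)%N) + x).
  under eq_bigr do rewrite mulrCA.
  under [leRHS]eq_bigr do rewrite mulrDr.
  rewrite -mulr_sumr big_split/= -mulr_suml L1_weight_telescope//.
  by set A := \sum_(_ < _) _; set B := \sum_(_ < _) _; lra.
apply: ler_sum => j _; apply: ler_wpM2l; first by rewrite subr_ge0 L1_weight_noninc.
have Pj : P (z (m - j)%N) by apply: Pz; rewrite leqW// leq_subr.
by have := semi_inner_young 1 Pj (Pz _ (leqnn _)); rewrite mulr1 expr1n mul1r.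
Qed.

End SemiInner.

(** * Square-integrable functions on a bounded open set *)

Section SquareIntegrable.
Variables (R : realType) (d : nat).
Implicit Types (Omega : set 'rV[R]_d) (u v w f : 'rV[R]_d -> R).
Local Notation leb := (lebesgue_rV R d).

Lemma continuous_measurable_rV f : continuous f -> measurable_fun setT f.
Proof.
move=> cf; apply: (measurability _ (RGenOpens.measurableE R)).
move=> _ [_ [a [b ->] <-]]; rewrite setTI; apply: open_measurable_rV.
by apply: open_comp; [move=> x _; exact: cf|exact: interval_open].
Qed.

Lemma bounded_lebesgue_rV_lty Omega : measurable Omega -> bounded_set Omega ->
  (leb Omega < +oo)%E.
Proof.
move=> mO /ex_strict_bound_gt0[r r0 Or].
have mb : forall i : 'I_d, measurable (`]-r, r[%classic : set R) by [].
pose B := [set x : 'rV[R]_d | forall i, `]-r, r[%classic (x ord0 i)].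
have mB : measurable B.
  rewrite (_ : B = \bigcap_(i : 'I_d)
      ((fun x : 'rV[R]_d => x ord0 i) @^-1` `]-r, r[%classic)).
    apply: fin_bigcap_measurable; first exact: finite_finset.
    by move=> i _; rewrite -[X in measurable X]setTI; exact: measurable_coord.
  by apply/seteqP; split => x /= h i; [move=> _; exact: h|exact: (h i I)].
apply: (@le_lt_trans _ _ (leb B)).
  apply: le_measure; rewrite ?inE//.
  move=> x Ox i /=; rewrite in_itv/= -ltr_norml.
  apply: le_lt_trans (Or _ Ox).
  rewrite /Num.norm/= mx_normrE.
  by apply: (le_bigmax _ (fun ij => `|x ij.1 ij.2|) (ord0, i)).
have := lebesgue_rV_box mb; rewrite -/B => ->.
rewrite ltey_eq; apply/orP; left.
elim/big_ind: _ => // [x y|i _]; first exact: fin_numM.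
by rewrite lebesgue_measure_itv/=; case: ifP.
Qed.

Variable Omega : set 'rV[R]_d.
Hypotheses (oO : open Omega) (bO : bounded_set Omega).

Let mO : measurable Omega. Proof. exact: open_measurable_rV. Qed.

Lemma L2_semilinear a u v : L2 Omega u -> L2 Omega v -> L2 Omega (a *: u + v).
Proof.
rewrite /L2 => Lu Lv.
rewrite (_ : _ \_ _ = a *: (u \_ Omega) + v \_ Omega).
  by have [_] := Lfun_submod_closed leb (lee1n 2); apply.
apply/funext => x; rewrite /patch !fctE.
by case: ifP => _; rewrite ?fctE ?scaler0 ?addr0.
Qed.

Lemma L2_0 : L2 Omega 0.
Proof.
rewrite /L2 (_ : _ \_ _ = 0); last by apply/funext => x; rewrite /patch; case: ifP.
by have [] := Lfun_submod_closed leb (lee1n 2).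
Qed.

Lemma L2_mul_integrable u v : L2 Omega u -> L2 Omega v ->
  leb.-integrable Omega (EFin \o (fun x => u x * v x)).
Proof.
move=> Lu Lv; apply/(integrable_mkcond _ mO).
have /Lfun1_integrable := Lfun2_mul_Lfun1 Lu Lv.
congr (_.-integrable _ _); apply/funext => x /=; rewrite /patch/=.
by case: ifP => //; rewrite mulr0.
Qed.

(** A bounded domain has finite measure and lies in a compact ball, on which a
continuous function is bounded. *)
Lemma L2_continuous f : continuous f -> L2 Omega f.
Proof.
move=> cf; have mf := continuous_measurable_rV cf.
have [C C0 fC] : exists2 C, 0 < C & forall x, Omega x -> `|f x| <= C.
  have [r r0 Or] := ex_strict_bound_gt0 bO.
  pose K := [set x : 'rV[R]_d | `|x| <= r].
  have cK : compact K.
    apply: bounded_closed_compact.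
      by exists r; split=> [|t /ltW rt x /le_trans]; [exact: num_real|exact].
    rewrite (_ : K = (fun x : 'rV[R]_d => `|x|) @^-1` [set t | t <= r])//.
    by apply: preimage_closed => [x _|]; [exact: norm_continuous|exact: closed_le].
  have /compact_bounded/ex_strict_bound_gt0[C C0 fC] : compact (f @` K).
    by apply: continuous_compact => //; exact: continuous_subspaceT.
  by exists C => // x /Or /ltW xr; apply/ltW/fC; exists x.
rewrite /L2 inE; apply/andP; split; rewrite inE/=.
  by apply/(measurable_restrictT _ mO); exact: measurable_funTS.
rewrite /finite_norm unlock /Lnorm poweR_lty//.
have : leb.-integrable Omega (EFin \o (fun x => `|f x| `^ 2)).
  apply: measurable_bounded_integrable => //.
  - exact: bounded_lebesgue_rV_lty.
  - apply: measurable_funTS; apply: (measurableT_comp (measurable_powR _)).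
    exact: measurableT_comp.
  - exists (C `^ 2); split=> [|t /ltW Ct x Ox /=]; first exact: num_real.
    rewrite ger0_norm ?powR_ge0//; apply: le_trans Ct.
    by rewrite ge0_ler_powR ?nnegrE ?(ltW C0)//; exact: fC.
move=> /(integrable_mkcond _ mO)/integrable_lty => /(_ measurableT).
rewrite (eq_integral (fun x => (`|(f \_ Omega) x| `^ 2)%:E))// => x _.
by rewrite /patch/=; case: ifP => //; rewrite normr0 powR0.
Qed.

Lemma l2dotC u v : l2dot Omega u v = l2dot Omega v u.
Proof. by apply: eq_Rintegral => x _; rewrite mulrC. Qed.

Lemma l2dot_ge0 u : 0 <= l2dot Omega u u.
Proof. by apply: Rintegral_ge0 => x _; rewrite -expr2 sqr_ge0. Qed.

Lemma l2dotL a u v w : L2 Omega u -> L2 Omega v -> L2 Omega w ->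
  l2dot Omega (a *: u + v) w = a * l2dot Omega u w + l2dot Omega v w.
Proof.
move=> Lu Lv Lw; have uw := L2_mul_integrable Lu Lw.
rewrite /l2dot -RintegralZl// -RintegralD//.
- by apply: eq_Rintegral => x _; rewrite !fctE mulrDl mulrA.
- by have := integrableZl mO a uw; apply: eq_integrable.
- exact: L2_mul_integrable.
Qed.

End SquareIntegrable.

(** * Positivity of the Gamma function *)

Section GammaPositive.
Variable R : realType.

(** As a real-valued integral, Gamma would be 0 if the integral diverged, so
positivity requires integrability. On the given range,
t^(z - 1) <= 1 + t <= 2 exp (t / 2), so that the integrand is at most
2 exp (- t / 2), which is 4 times an exponential density. It is at least
exp (- 2) on the interval from 1 to 2. *)
Lemma Gamma_gt0 (z : R) : 1 <= z <= 2 -> 0 < Gamma z.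
Proof.
move=> /andP[z1 z2].
pose g t : R := t `^ (z - 1) * expR (- t).
have g0 t : 0 <= g t by rewrite mulr_ge0 ?powR_ge0 ?expR_ge0.
have mg : measurable_fun setT g.
  apply: measurable_funM; first exact: measurable_powR.
  by apply: measurableT_comp => //; exact: measurable_expR.
pose mu : {measure set (measurableTypeR R) -> \bar R} := lebesgue_measure.
have iexp : mu.-integrable `]0, +oo[
    (fun t => 4%:E * (EFin \o exponential_pdf 2^-1) t)%E.
  have h0 : 0 < 2^-1 :> R by rewrite invr_gt0.
  have mI : measurable (`]0, +oo[%classic : set (measurableTypeR R)).
    exact: measurable_itv.
  exact: (integrableS (@measurableT _ _) mI (@subsetT _ _)
    (integrableZl (@measurableT _ _) 4 (integrable_exponential_pdf h0))).
have ig : mu.-integrable `]0, +oo[ (EFin \o g).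
  apply: (le_integrable _ _ _ iexp) => //.
  - by apply/measurable_EFinP; exact: measurable_funTS.
  - move=> t /=; rewrite in_itv/= andbT => t0.
    rewrite /= lee_fin !ger0_norm ?mulr_ge0 ?exponential_pdf_ge0 ?powR_ge0 ?expR_ge0//.
    rewrite exponential_pdfE ?(ltW t0)//.
    have tz : t `^ (z - 1) <= 1 + t.
      have [t1|/ltW t1] := leP 1 t.
        apply: (@le_trans _ _ (t `^ 1)); first by rewrite ler_powR//; lra.
        by rewrite powRr1 ?(ltW t0)//; lra.
      apply: (@le_trans _ _ (1 `^ (z - 1))); last by rewrite powR1; lra.
      by rewrite ge0_ler_powR ?nnegrE//; lra.
    have e1 : 1 + t / 2 <= expR (t / 2) := expR_ge1Dx _.
    rewrite /g (_ : - t = - 2^-1 * t + - (t / 2)); last by field.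
    rewrite expRD expRN.
    have e0 : 0 < expR (t / 2) by exact: expR_gt0.
    set E := expR (t / 2) in e0 e1 *; set F := expR _.
    rewrite mulrCA (_ : 4 * (2^-1 * F) = F * 2); last by field.
    rewrite ler_wpM2l ?expR_ge0// ler_pdivrMr//; lra.
have sub : `[1, 2]%classic `<=` (`]0, +oo[%classic : set R).
  by move=> t /=; rewrite !in_itv/= andbT => /andP[/(lt_le_trans ltr01)].
have lb t : `[1, 2]%classic t -> expR (- 2) <= g t.
  rewrite /= in_itv/= => /andP[t1 t2]; rewrite -[leLHS]mul1r /g.
  apply: ler_pM => //; rewrite ?expR_ge0 ?ler_expR ?lerN2//.
  rewrite -[leLHS](powRr0 t) ler_powR//; lra.
rewrite /Gamma /Rintegral fine_gt0//; apply/andP; split; last first.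
  by apply: integrable_lty.
apply: (@lt_le_trans _ _ (\int[mu]_(t in `[1%R, 2%R]) (expR (- 2))%:E)%E).
  rewrite integral_cst//= mule_gt0 ?lte_fin ?expR_gt0//.
  suff -> : mu `[1, 2]%classic = 1%:E by rewrite lte_fin.
  by rewrite [LHS]lebesgue_measure_itv/= lte_fin ltr1n -EFinB; congr EFin; lra.
apply: (@le_trans _ _ (\int[mu]_(t in `[1%R, 2%R]) (g t)%:E)%E).
  apply: ge0_le_integral => //.
  by apply/measurable_EFinP; exact: measurable_funTS.
apply: ge0_subset_integral => //; last by move=> t _; rewrite lee_fin.
by apply/measurable_EFinP; exact: measurable_funTS.
Qed.

End GammaPositive.

(** * Weak gradients and finite element functions *)

Section FiniteElements.
Variables (R : realType) (d : nat) (Omega : set 'rV[R]_d).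
Hypotheses (oO : open Omega) (bO : bounded_set Omega).
Local Notation leb := (lebesgue_rV R d).
Local Notation fct := ('rV[R]_d -> R).
Implicit Types (u v w f phi : fct) (G H : 'I_d -> fct).

Let mO : measurable Omega. Proof. exact: open_measurable_rV. Qed.

Lemma l2dot_semi_inner : semi_inner_on (L2 Omega) (l2dot Omega).
Proof.
split; [exact: L2_0|exact: L2_semilinear|exact: l2dotC|exact: l2dotL|].
exact: l2dot_ge0.
Qed.

Lemma l2dot_vec_ge0 G : 0 <= l2dot_vec Omega G G.
Proof. by apply: sumr_ge0 => i _; exact: l2dot_ge0. Qed.

Lemma l2dot_ae0 u v : L2 Omega u -> L2 Omega v ->
  {ae leb, forall x, Omega x -> u x = 0} -> l2dot Omega u v = 0.
Proof.
move=> Lu Lv u0; rewrite /l2dot /Rintegral.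
rewrite (ae_eq_integral (cst 0%E))// ?integral_cst ?mul0e//.
  by have /integrableP[] := L2_mul_integrable oO Lu Lv.
by apply: filterS u0 => x ux Ox; rewrite ux// mul0r.
Qed.

Lemma L2_test phi : test_function Omega phi -> L2 Omega phi.
Proof. by move=> [/(_ 0%N)[cphi _] _]; exact: L2_continuous. Qed.

Lemma L2_partial_test phi i : test_function Omega phi -> L2 Omega (partial i phi).
Proof.
move=> [/(_ 1%N)[_ /(_ i)[_ [cphi _]]] _]; exact: L2_continuous.
Qed.

Lemma weak_gradientL a u v G H : L2 Omega u -> L2 Omega v ->
  weak_gradient Omega u G -> weak_gradient Omega v H ->
  weak_gradient Omega (a *: u + v) (a *: G + H).
Proof.
move=> Lu Lv uG vH i; have [LG GP] := uG i; have [LH HP] := vH i.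
have e := l2dot_semi_inner; split; first exact: L2_semilinear.
move=> phi tphi; have Lphi := L2_test tphi; have Ldphi := L2_partial_test i tphi.
by rewrite !(semi_innerL e)// GP// HP// mulrN opprD.
Qed.

(** The initial value of the scheme vanishes almost everywhere, so its gradient
may be taken to be 0. *)
Lemma weak_gradient_ae0 u : L2 Omega u ->
  {ae leb, forall x, Omega x -> u x = 0} -> weak_gradient Omega u 0.
Proof.
move=> Lu u0 i; split=> [|phi tphi]; first exact: L2_0.
rewrite l2dot_ae0//; last exact: L2_partial_test.
rewrite (l2dot_ae0 (u := 0 i))//; [by rewrite oppr0|exact: L2_0|exact: L2_test|].
by apply: filterE.
Qed.

Lemma is_P1_onL (A : set 'rV[R]_d) a u v : is_P1_on A u -> is_P1_on A v ->
  is_P1_on A (a *: u + v).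
Proof.
move=> [p [b up]] [q [c vq]]; exists (a *: p + q), (a * b + c).
near=> x => Ax; rewrite -[LHS]/(a * u x + v x) (near up x)// (near vq x)//.
rewrite mulrDr mulr_sumr addrACA -big_split/=; congr (_ + _).
by apply: eq_bigr => i _; rewrite mulrA -mulrDl.
Unshelve. all: by end_near. Qed.

Lemma is_P1_on0 (A : set 'rV[R]_d) : is_P1_on A 0.
Proof.
exists (fun=> 0), 0; apply: filterE => x _.
by rewrite big1 ?addr0// => i _; rewrite mul0r.
Qed.

Variable Th : set (set 'rV[R]_d).

Definition fe_graph (z : fct * ('I_d -> fct)) : Prop :=
  [/\ L2 Omega z.1, weak_gradient Omega z.1 z.2 &
      forall A, Th A -> is_P1_on A z.1].

Definition energy (z y : fct * ('I_d -> fct)) : R :=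
  l2dot_vec Omega z.2 y.2 + l2dot Omega z.1 y.1.

Lemma fst_semilinear (U V : lmodType R) a (x y : U * V) :
  (a *: x + y).1 = a *: x.1 + y.1.
Proof. by []. Qed.

Lemma snd_semilinear (U V : lmodType R) a (x y : U * V) :
  (a *: x + y).2 = a *: x.2 + y.2.
Proof. by []. Qed.

Lemma energy_semi_inner : semi_inner_on fe_graph energy.
Proof.
have e := l2dot_semi_inner; split.
- split; first exact: L2_0.
    by apply: weak_gradient_ae0; [exact: L2_0|exact: filterE].
  by move=> A _; exact: is_P1_on0.
- move=> a x y [Lx Gx Px] [Ly Gy Py].
  rewrite /fe_graph fst_semilinear snd_semilinear.
  split; [exact: L2_semilinear|exact: weak_gradientL|].
  by move=> A ThA; apply: is_P1_onL; [exact: Px|exact: Py].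
- move=> x y; rewrite /energy l2dotC; congr (_ + _).
  by apply: eq_bigr => i _; exact: l2dotC.
- move=> a x y z [Lx Gx Px] [Ly Gy Py] [Lz Gz Pz].
  rewrite /energy fst_semilinear snd_semilinear.
  rewrite (semi_innerL e)// mulrDr addrACA; congr (_ + _).
  rewrite /l2dot_vec mulr_sumr -big_split/=; apply: eq_bigr => i _.
  by rewrite (semi_innerL e)//; [case: (Gx i)|case: (Gy i)|case: (Gz i)].
- by move=> x; rewrite addr_ge0 ?l2dot_vec_ge0 ?l2dot_ge0.
Qed.

Lemma L1_caputoE alpha tau (u : nat -> fct) m : L1_caputo alpha tau u m =
  L1_diff alpha (Gamma (2 - alpha) * tau `^ alpha)^-1 u m.
Proof.
by rewrite /L1_diff fct_sumE; apply/funext => x.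
Qed.

End FiniteElements.

(** * Energy estimates for the scheme *)

Section SchemeBounds.
Variables (R : realType) (d : nat) (Omega : set 'rV[R]_d) (T alpha K : R).
Variables (mu : R -> R) (Th : set (set 'rV[R]_d)) (M : nat).
Variables (f : 'rV[R]_d -> R) (u : nat -> 'rV[R]_d -> R).
Hypotheses (oO : open Omega) (bO : bounded_set Omega).
Hypotheses (T0 : 0 < T) (a01 : 0 < alpha < 1) (M0 : (0 < M)%N).
Hypotheses (muK : forall t, 0 <= t <= T -> `|mu t| <= K) (Lf : L2 Omega f).
Hypothesis uP : scheme_solution Omega T alpha mu Th M f u.
Local Notation fct := ('rV[R]_d -> R).
Implicit Type z : nat -> fct * ('I_d -> fct).

Let c : R := (Gamma (2 - alpha) * (T / M%:R) `^ alpha)^-1.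

Let Gamma0 : 0 < Gamma (2 - alpha).
Proof. by case/andP: a01 => a0 a1; apply: Gamma_gt0; apply/andP; split; lra. Qed.

Let s0 : 0 < 1 - alpha. Proof. by case/andP: a01; rewrite subr_gt0. Qed.

Let tau0 : 0 < T / M%:R. Proof. by rewrite divr_gt0// ltr0n. Qed.

Let c0 : 0 < c. Proof. by rewrite invr_gt0 mulr_gt0// powR_gt0. Qed.

Lemma scheme_solution_L2 m : (m <= M)%N -> L2 Omega (u m).
Proof. by case: uP => uV _ _ /uV[[]]. Qed.

Lemma scheme_solution0 v : L2 Omega v -> l2dot Omega (u 0%N) v = 0.
Proof.
by case: uP => _ u0 _ Lv; exact: (l2dot_ae0 oO (scheme_solution_L2 _)).
Qed.

Lemma data_sqr_le m : (m < M)%N ->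
  mu (m.+1%:R * (T / M%:R)) ^+ 2 * l2dot Omega f f <= K ^+ 2 * l2dot Omega f f.
Proof.
move=> mM; apply: ler_wpM2r; first exact: l2dot_ge0.
rewrite -real_normK ?num_real// ler_sqr ?nnegrE//; last first.
  by apply: (le_trans (normr_ge0 (mu 0))); apply: muK; rewrite lexx ltW.
apply: muK; rewrite mulr_ge0 ?ler0n ?(ltW tau0)//= mulrCA ger_pMr//.
by rewrite ler_pdivrMr ?ltr0n// mul1r ler_nat.
Qed.

(** The scheme holds for every representative of the gradients, so one may choose
0 at time 0 and the representative to be estimated at time m. *)
Lemma scheme_graph m Du : (0 < m <= M)%N -> weak_gradient Omega (u m) Du ->
  exists z, [/\ fst \o z = u, forall k, (k <= M)%N -> fe_graph Omega Th (z k),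
    (z 0%N).2 = 0 & (z m).2 = Du].
Proof.
case: uP => uV u0 _ /andP[m0 mM] uDu.
have /choice[G GP] : forall k, exists Gk : 'I_d -> fct,
    (k <= M)%N -> weak_gradient Omega (u k) Gk.
  move=> k; case: (leqP k M) => [/uV[[_ [Gk uGk]] _]|_]; first by exists Gk.
  by exists 0.
pose H k := if k == 0%N then 0 else if k == m then Du else G k.
exists (fun k => (u k, H k)); split=> //; last by rewrite /H/= eqxx gtn_eqF.
move=> k kM; have [_ uP1] := uV _ kM; split=> //=; first exact: scheme_solution_L2.
rewrite /H; case: eqP => [->|_].
  by apply: weak_gradient_ae0 => //; exact: scheme_solution_L2.
by case: eqP => [->//|_]; exact: GP.
Qed.

Lemma scheme_test z m y : fst \o z = u ->
  (forall k, (k <= M)%N -> fe_graph Omega Th (z k)) -> (m < M)%N ->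
  fe_graph Omega Th y ->
  l2dot Omega (L1_diff alpha c z m).1 y.1 + energy Omega (z m.+1) y =
  mu (m.+1%:R * (T / M%:R)) * l2dot Omega f y.1.
Proof.
move=> zu zP mM [Ly Gy Py]; case: uP => _ _ eqn.
have zE k : (z k).1 = u k by rewrite -zu.
have [_ Gz _] := zP _ mM; rewrite zE in Gz.
rewrite L1_diff_fst zu -L1_caputoE /energy zE addrA; apply: eqn => //.
by split=> //; split=> //; exists y.2.
Qed.

(** Testing with u_{m+1}: Young's inequality bounds the source by half of
K^2 |f|^2 and half of |u_{m+1}|^2, and the zeroth order term absorbs the
latter. The gradient term has a favourable sign. *)
Lemma scheme_L2_bound m : (m <= M)%N ->
  l2dot Omega (u m) (u m) <= K ^+ 2 * l2dot Omega f f.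
Proof.
have [->|m0 mM] := posnP m.
  rewrite scheme_solution0; last exact: scheme_solution_L2.
  by rewrite mulr_ge0 ?sqr_ge0 ?l2dot_ge0.
have e := l2dot_semi_inner oO.
apply: (L1_weight_comparison (E := fun k => l2dot Omega (u k) (u k)) (k := 1)
  a01 c0 ler01 (M := M)); last by rewrite m0.
move=> {m0 mM}k kM.
have [Du uDu] : exists G, weak_gradient Omega (u k.+1) G.
  by case: uP => /(_ _ kM)[[]].
have [z [zu zP _ _]] := scheme_graph (kM : (0 < k.+1 <= M)%N) uDu.
have zE j : (z j).1 = u j by rewrite -zu.
have := scheme_test zu zP kM (zP _ kM).
rewrite /energy L1_diff_fst zu !zE.
have := L1_diff_coercive e a01 (ltW c0) (z := u) (m := k).
have := semi_inner_young e (mu (k.+1%:R * (T / M%:R)))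
  (scheme_solution_L2 kM) Lf.
have := data_sqr_le kM.
rewrite (l2dotC Omega (u k.+1) f).
have := l2dot_vec_ge0 Omega (z k.+1).2.
move=> h1 h2 h3 h4.
have {}h4 := h4 (fun j jk => scheme_solution_L2 (leq_trans jk kM)) scheme_solution0.
(* The term 2 c d_k G of the comparison principle is slack here: the damping
   alone absorbs the source, and only the sign of this term matters. *)
have h5 : 0 <= c * L1_weight alpha k * (K ^+ 2 * l2dot Omega f f).
  apply: mulr_ge0; first by rewrite mulr_ge0 ?(ltW c0)// ltW// L1_weight_gt0.
  by rewrite mulr_ge0 ?sqr_ge0 ?l2dot_ge0.
lra.
Qed.

(** Testing with the L1 difference of u: the square of its L2 norm absorbs the
source entirely. *)
Lemma scheme_gradient_bound m Du : (0 < m <= M)%N ->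
  weak_gradient Omega (u m) Du ->
  l2dot_vec Omega Du Du <=
  K ^+ 2 * Gamma (2 - alpha) * T `^ alpha / (4 * (1 - alpha)) * l2dot Omega f f.
Proof.
move=> m0M uDu; have [z [zu zP z0 <-]] := scheme_graph m0M uDu.
have zE j : (z j).1 = u j by rewrite -zu.
have e := energy_semi_inner oO bO Th; have e2 := l2dot_semi_inner oO.
set G := _ * l2dot Omega f f.
suff: energy Omega (z m) (z m) <= G.
  by apply: le_trans; rewrite /energy lerDl l2dot_ge0.
apply: (L1_weight_comparison (E := fun k => energy Omega (z k) (z k)) (k := 0)
  a01 c0 (lexx _) _ m0M).
move=> {m0M uDu}m mM.
have zPm k : (k <= m.+1)%N -> fe_graph Omega Th (z k).
  by move=> km; apply/zP/(leq_trans km).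
have Dz : fe_graph Omega Th (L1_diff alpha c z m) by exact: (L1_diff_dom e).
have test := scheme_test zu zP mM Dz.
have [Ldz _ _] := Dz.
have young := semi_inner_young e2 (mu (m.+1%:R * (T / M%:R)) / 2) Ldz Lf.
rewrite (semi_innerC e2 _ f) in young.
have z0' : forall y, fe_graph Omega Th y -> energy Omega (z 0%N) y = 0.
  move=> y [Ly Gy _]; rewrite /energy zE scheme_solution0// z0 addr0.
  rewrite /l2dot_vec big1// => i _.
  by apply: (l2dot_ae0 oO); [exact: L2_0|by case: (Gy i)|by apply: filterE].
have := L1_diff_coercive e a01 (ltW c0) zPm z0'.
rewrite (semi_innerC e (L1_diff _ _ _ _)).
have data := data_sqr_le mM.
(* The time step cancels here: c and d_m scale as M^alpha and M^(- alpha). *)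
have KG : K ^+ 2 * l2dot Omega f f <= 4 * c * L1_weight alpha m * G.
  have M0' : 0 < M%:R :> R by rewrite ltr0n.
  have TM : T `^ alpha = (T / M%:R) `^ alpha * M%:R `^ alpha.
    by rewrite -powRM ?divfK ?gt_eqF// ltW.
  have dM : 1 - alpha <= L1_weight alpha m * M%:R `^ alpha.
    rewrite -ler_pdivrMr ?powR_gt0// -powRN.
    apply: le_trans (L1_weight_ge _ a01); apply: ler_wpM2l; first exact: ltW.
    rewrite !powRN lef_pV2 ?posrE ?powR_gt0// ge0_ler_powR ?nnegrE ?ler_nat//.
    by case/andP: a01 => /ltW.
  have -> : 4 * c * L1_weight alpha m * G =
      L1_weight alpha m * M%:R `^ alpha / (1 - alpha) * (K ^+ 2 * l2dot Omega f f).
    have := powR_gt0 alpha tau0.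
    rewrite /G /c TM; move: (Gamma _) Gamma0 (_ `^ _) (_ `^ _) => g g0 t t' t0.
    by field; rewrite !gt_eqF.
  apply: ler_peMl; first by rewrite mulr_ge0 ?sqr_ge0 ?l2dot_ge0.
  by rewrite ler_pdivlMr// mul1r.
move: test young data KG.
set D := l2dot _ _ (L1_diff alpha c z m).1.
lra.
Qed.

End SchemeBounds.

Theorem lemma3p3 (R : realType) (d : nat) (Omega : set 'rV[R]_d)
    (T alpha : R) (mu : R -> R)
    (hd : (0 < d <= 3)%N) (hOmega : convex_polytopal_domain Omega)
    (hT : 0 < T) (halpha : 0 < alpha < 1)
    (mmu : measurable_fun `[0, T] mu)
    (bmu : exists K : R, forall t, 0 <= t <= T -> `|mu t| <= K) :
  unconditionally_stable Omega T alpha mu /\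
  exists C0 C1 : R, [/\ 0 < C0, 0 < C1 &
    forall (Th : set (set 'rV[R]_d)) (kappa h : R) (M : nat)
        (f : 'rV[R]_d -> R) (u : nat -> 'rV[R]_d -> R),
      triangulation Omega Th -> shape_regular kappa Th -> mesh_size Th h ->
      (0 < M)%N -> S_space Omega Th f ->
      scheme_solution Omega T alpha mu Th M f u ->
      forall m, (1 <= m <= M)%N ->
        l2norm Omega (u m) <= C0 * l2norm Omega f /\
        forall Du, weak_gradient Omega (u m) Du ->
          l2norm_vec Omega Du ^+ 2 <= C1 * l2norm Omega f ^+ 2].
Proof.
have [oO _ bO _ _] := hOmega.
have [K [K0 muK]] : exists K, 0 < K /\ forall t, 0 <= t <= T -> `|mu t| <= K.
  (* The maximum with 1 makes the constants of the theorem positive. *)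
  have [K muK] := bmu; exists (Num.max K 1).
  rewrite lt_max ltr01 orbT; split=> // t /muK; rewrite le_max => ->//.
have bound Th M f u : (0 < M)%N -> S_space Omega Th f ->
    scheme_solution Omega T alpha mu Th M f u -> forall m, (m <= M)%N ->
    l2norm Omega (u m) <= K * l2norm Omega f.
  move=> M0 [Lf _] uP m mM.
  rewrite -[K in leRHS](ger0_norm (ltW K0)) -sqrtr_sqr -sqrtrM ?sqr_ge0//.
  by rewrite ler_wsqrtr// (scheme_L2_bound oO bO hT halpha M0 muK Lf uP).
split; first by exists K => Th kappa h M f u _ _ _ M0 fS uP m; exact: bound uP m.
exists K, (K ^+ 2 * Gamma (2 - alpha) * T `^ alpha / (4 * (1 - alpha))).
split=> //.
  have G0 : 0 < Gamma (2 - alpha).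
    by case/andP: halpha => a0 a1; apply: Gamma_gt0; apply/andP; split; lra.
  by rewrite divr_gt0 ?mulr_gt0 ?exprn_gt0 ?powR_gt0//; lra.
move=> Th kappa h M f u _ _ _ M0 fS uP m m0M; split=> [|Du uDu].
  by case/andP: m0M => _; exact: bound uP m.
rewrite !sqr_sqrtr ?l2dot_ge0 ?l2dot_vec_ge0//.
by apply: (scheme_gradient_bound oO bO hT halpha M0 muK _ uP m0M) => //; case: fS.
Qed.
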